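(* For all $n\geq2$, the complete graph $K_n$ satisfies $\mathrm{pmd}(K_n)=2n-3$.
   Context: A matching $M$ (a set of pairwise disjoint edges) of a graph $\Gamma=(V,E)$ is positive if there is $w\colon V\to\mathbb{R}$ with $w(u)+w(v)>0$ for every $uv\in M$ and $w(u)+w(v)<0$ for every $uv\in E\setminus M$. A positive matching decomposition (pmd) of $\Gamma$ is a partition $E=E_1\cup\cdots\cup E_p$ into pairwise disjoint subsets such that $E_i$ is a positive matching of $(V,E\setminus\bigcup_{j<i}E_j)$ for $i=1,\ldots,p$. $\mathrm{pmd}(\Gamma)$ denotes the smallest $p$ for which $\Gamma$ has a pmd with $p$ parts. *)

(* Defs.v *)
From HB Require Import structures.
From mathcomp Require Import all_boot all_order all_algebra.
From mathcomp Require Import boolp reals.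

Set Implicit Arguments.
Unset Strict Implicit.
Unset Printing Implicit Defensive.

Import Order.TTheory GRing.Theory Num.Theory.
Local Open Scope ring_scope.

Record sgraph (V : finType) := SGraph {
  edges : {set {set V}};
  edges_card2 : [forall e in edges, #|e| == 2%N] }.

Lemma del_edges_subproof (V : finType) (G : sgraph V) (F : {set {set V}}) :
  [forall e in edges G :\: F, #|e| == 2%N].
Proof.
apply/forall_inP => e /setDP[eG _].
exact: (forall_inP (edges_card2 G)).
Qed.

Definition del_edges (V : finType) (G : sgraph V) (F : {set {set V}}) :
  sgraph V := SGraph (del_edges_subproof G F).

Lemma complete_graph_subproof (n : nat) :
  [forall e in [set e : {set 'I_n} | #|e| == 2%N], #|e| == 2%N].
Proof. by apply/forall_inP => e; rewrite inE. Qed.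

Definition complete_graph (n : nat) : sgraph 'I_n :=
  SGraph (complete_graph_subproof n).

Definition is_matching (V : finType) (G : sgraph V) (M : {set {set V}}) : Prop :=
  M \subset edges G /\ trivIset M.

Definition positive_matching (R : realType) (V : finType) (G : sgraph V)
    (M : {set {set V}}) : Prop :=
  is_matching G M /\
  exists w : V -> R,
    (forall u v : V, [set u; v] \in M -> 0 < w u + w v) /\
    (forall u v : V, [set u; v] \in edges G :\: M -> w u + w v < 0).

Definition is_pmd (R : realType) (V : finType) (G : sgraph V) (p : nat)
    (E : 'I_p -> {set {set V}}) : Prop :=
  [/\ \bigcup_(i < p) E i = edges G,
      forall i : 'I_p, E i != set0,
      forall i j : 'I_p, i != j -> [disjoint E i & E j] &
      forall i : 'I_p,
        positive_matching R (del_edges G (\bigcup_(j < p | (j < i)%N) E j))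
          (E i)].

Definition has_pmd (R : realType) (V : finType) (G : sgraph V) (p : nat) :
    Prop :=
  exists E : 'I_p -> {set {set V}}, is_pmd R G E.

(* Taking the edges one at a time always gives a decomposition. *)
Lemma has_pmd_exists (R : realType) (V : finType) (G : sgraph V) :
  exists p : nat, `[< has_pmd R G p >].
Proof.
exists #|edges G|; apply/asboolP.
exists (fun i => [set enum_val i]); split.
- apply/setP => e; apply/bigcupP/idP => [[i _ /set1P ->]|eG].
    exact: enum_valP.
  by exists (enum_rank_in eG e) => //; rewrite enum_rankK_in ?set11.
- by move=> i; apply/set0Pn; exists (enum_val i); rewrite set11.
- move=> i j ij; rewrite disjoints1 in_set1.
  by apply: contra ij => /eqP/enum_val_inj ->.
move=> i; set F := \bigcup_(_ < _ | _) _; set e := enum_val i.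
have eG : e \in edges G by exact: enum_valP.
split; first split.
- rewrite sub1set /= inE eG andbT; apply/bigcupP => -[j ji /set1P].
  by move=> /enum_val_inj ij; rewrite ij ltnn in ji.
- by apply/trivIsetP => A B /set1P -> /set1P ->; rewrite eqxx.
exists (fun x => if x \in e then 1 else - 2%:R); split=> u v.
  by move=> /set1P <-; rewrite !inE !eqxx orbT /= addr_gt0.
rewrite /= !inE => /andP[uve /andP[_ uvG]].
have c2 f : f \in edges G -> #|f| = 2%N.
  by move=> fG; apply/eqP/(forall_inP (edges_card2 G)).
have : ~~ ((u \in e) && (v \in e)).
  apply: contra uve => /andP[ue ve].
  by rewrite eqEcard subUset !sub1set ue ve !c2.
have lt12 : (1 : R) - 2%:R < 0 by rewrite subr_lt0 ltr1n.
have lt20 : - 2%:R < 0 :> R by rewrite oppr_lt0 ltr0n.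
case: (u \in e); case: (v \in e) => //= _.
- by rewrite addrC.
- by rewrite -opprD oppr_lt0 addr_gt0 ?ltr0n.
Qed.

Definition pmd (R : realType) (V : finType) (G : sgraph V) : nat :=
  ex_minn (has_pmd_exists R G).

(* Main.v *)
Require Import Defs.
From mathcomp Require Import all_boot all_order all_algebra.
From mathcomp Require Import boolp reals.
From mathcomp Require Import zify lra.

(** Upper bound: on the vertices 0, ..., n - 1, put the edge ij into the part
    number i + j. These sums take the 2n - 3 values 1, ..., 2n - 3, edges with
    the same sum are disjoint, and once the edges of sum below s are gone, the
    weight w(i) = (s + 1/2) / 2 - i, used below after scaling by 4, separates
    the sum s from the larger ones ([sum_part_pmd]).

    Lower bound: view a decomposition as a colouring of the edges by the
    indices of their parts. It is proper, and if two disjoint edges ab and xy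
    have the same colour k, then two edges that share an endpoint, both inside
    {a, b, x, y}, have colours below k: if a is heaviest among the four, then
    ax and ay weigh at least as much as xy, so they are positive and must have
    been removed before step k ([same_part_cherry]). Hence, among all pairs of
    edges sharing an endpoint, a pair ab, ac whose larger
    colour is as small as possible consists of edges whose colours occur
    nowhere else. Deleting the vertex a therefore destroys at least two
    colours, and the condition on the colouring is inherited by the remaining
    vertices; by induction a set of m >= 2 vertices carries at least 2m - 3
    colours ([card_colors_ge]). *)

Set Implicit Arguments.
Unset Strict Implicit.
Unset Printing Implicit Defensive.

Import Order.TTheory GRing.Theory Num.Theory.
Local Open Scope ring_scope.

(** * Colourings of the edges of a complete graph *)

Section Colorings.
Variables (V : finType) (p : nat) (c : V -> V -> 'I_p).

Definition colors (S : {set V}) : {set 'I_p} :=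
  [set c u v | u in S, v in S :\ u].

Definition proper_coloring : Prop :=
  forall a b b', a != b -> a != b' -> c a b = c a b' -> b = b'.

(** A cherry is a pair of edges [z u], [z v] with a common endpoint [z]. This
    is all that the lower bound retains of the positivity of the parts. *)
Definition repetition_forces_cherry : Prop :=
  forall a b x y, uniq [:: a; b; x; y] -> c a b = c x y ->
  exists z u v, [/\ {subset [:: z; u; v] <= [:: a; b; x; y]},
    uniq [:: z; u; v], (c z u < c a b)%N & (c z v < c a b)%N].

Hypothesis cC : forall u v, c u v = c v u.
Hypothesis c_proper : proper_coloring.
Hypothesis c_cherry : repetition_forces_cherry.

(** Let [a] be the centre of a cherry in [S] whose larger colour is
    minimal. A repetition of one of its two colours away from [a] would force
    a cherry with both colours smaller. *)
Lemma exists_vertex_two_private_colors (S : {set V}) :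
  (3 <= #|S|)%N ->
  exists2 a, a \in S & (#|colors (S :\ a)| + 2 <= #|colors S|)%N.
Proof.
move=> S3.
pose is_cherry (t : V * V * V) :=
  [&& t.1.1 \in S, t.1.2 \in S, t.2 \in S & uniq [:: t.1.1; t.1.2; t.2]].
pose top (t : V * V * V) := maxn (c t.1.1 t.1.2) (c t.1.1 t.2).
have [t0 t0P] : exists t, is_cherry t.
  have /card_gt2P[a [b [d [[aS bS dS] [ab bd da]]]]] := S3.
  exists (a, b, d); rewrite /is_cherry /= !inE negb_or aS bS dS ab bd.
  by rewrite eq_sym da.
case: (@arg_minnP _ t0 is_cherry top t0P).
case=> -[a b] d /=; rewrite /is_cherry /top /=.
move=> /and4P[aS bS dS /and3P[]]; rewrite !inE negb_or => /andP[ab ad] bd _ tmin.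
have private t : t \in S -> a != t ->
    (c a t <= maxn (c a b) (c a d))%N -> c a t \notin colors (S :\ a).
  move=> tS aDt tle; apply/imset2P => -[x y]; rewrite !inE.
  move=> /andP[xa xS] /and3P[yx ya yS] e.
  have xt : x != t.
    apply: contraNneq ya => xt; subst x; apply/eqP/esym.
    by apply: (c_proper _ _ (etrans (cC t a) e)); rewrite eq_sym.
  have yt : y != t.
    apply: contraNneq xa => yt; subst y; apply/eqP/esym.
    apply: (c_proper _ _ (etrans (cC t a) (etrans e (cC x t)))).
      by rewrite eq_sym.
    by [].
  have [|z [u [v [zs zu l1 l2]]]] := c_cherry _ e.
    rewrite /= !inE !negb_or aDt (eq_sym a x) xa (eq_sym a y) ya.
    by rewrite (eq_sym t x) xt (eq_sym t y) yt eq_sym yx.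
  have inS r : r \in [:: z; u; v] -> r \in S.
    by move=> /zs; rewrite !inE => /or4P[] /eqP ->.
  have /tmin/= : is_cherry (z, u, v).
    by apply/and4P; split; rewrite ?zu ?inS // !inE eqxx ?orbT.
  by rewrite leqNgt (leq_trans _ tle) // gtn_max l1 l2.
exists a => //.
have cbd : c a b != c a d.
  by apply: contra bd => /eqP e; apply/eqP/(c_proper ab ad).
have <- : #|[set c a b; c a d]| = 2%N by rewrite cards2 cbd.
have dis : [disjoint colors (S :\ a) & [set c a b; c a d]].
  rewrite disjoint_sym disjoints_subset; apply/subsetP => i.
  by rewrite !inE => /orP[] /eqP ->; apply: private; rewrite ?leq_maxl ?leq_maxr.
rewrite -cardsUI (disjoint_setI0 dis) cards0 addn0 subset_leq_card // subUset.
apply/andP; split.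
  apply/subsetP => i /imset2P[x y]; rewrite !inE.
  by move=> /andP[_ xS] /and3P[yx _ yS] ->; apply/imset2_f; rewrite ?inE ?yx.
apply/subsetP => i; rewrite !inE.
by case/orP => /eqP ->; apply/imset2_f; rewrite // !inE eq_sym ?ab ?ad.
Qed.

Lemma card_colors_ge (S : {set V}) :
  (2 <= #|S|)%N -> (2 * #|S| - 3 <= #|colors S|)%N.
Proof.
move: {2}#|S| (leqnn #|S|) => m; elim: m S => [|m IH] S; first by lia.
move=> Sm; rewrite leq_eqVlt => /orP[/eqP S2|S3].
  have /card_gt1P[a [b [aS bS ab]]] : (1 < #|S|)%N by rewrite -S2.
  rewrite -S2 card_gt0; apply/set0Pn; exists (c a b); apply: imset2_f => //.
  by rewrite !inE eq_sym ab.
have [a aS ca] := exists_vertex_two_private_colors S3.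
have cS := cardsD1 a S; rewrite aS in cS.
have := IH (S :\ a); lia.
Qed.

End Colorings.

(** * Decompositions as colourings *)

Lemma set2_inj_r (V : finType) (a b b' : V) :
  a != b -> [set a; b] = [set a; b'] -> b = b'.
Proof.
move=> ab /setP/(_ b); rewrite !inE eqxx orbT.
by move/esym/orP => [/eqP ba|/eqP //]; rewrite ba eqxx in ab.
Qed.

Section LowerBound.
Variables (R : realType) (n p : nat) (E : 'I_p -> {set {set 'I_n}}).
Hypothesis Epmd : is_pmd R (complete_graph n) E.
Variable part : {set 'I_n} -> 'I_p.
Hypothesis partP : forall e, e \in edges (complete_graph n) -> e \in E (part e).

Let c u v := part [set u; v].

Let edge2 (u v : 'I_n) : u != v -> [set u; v] \in E (c u v).
Proof. by move=> uv; apply: partP; rewrite /= inE cards2 uv. Qed.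

Let part_sym u v : c u v = c v u.
Proof. by rewrite /c setUC. Qed.

Lemma part_proper : proper_coloring c.
Proof.
move=> a b b' ab ab' e; have [_ _ _ /(_ (c a b))[[_ /trivIsetP tI] _]] := Epmd.
apply: (set2_inj_r ab); apply/eqP/negPn/negP => ne.
have := tI _ _ (edge2 ab); rewrite e => /(_ _ (edge2 ab') ne).
by move/pred0P/(_ a); rewrite /= !inE eqxx.
Qed.

Let later_edges (k : 'I_p) : {set {set 'I_n}} :=
  edges (del_edges (complete_graph n) (\bigcup_(j < p | (j < k)%N) E j))
    :\: E k.

(** In a complete graph every pair lies in some part, and the pairs in the parts
    after [k] all have negative weight. *)
Lemma part_le_of_pos (k : 'I_p) (w : 'I_n -> R) (u v : 'I_n) :
  (forall u v, [set u; v] \in later_edges k -> w u + w v < 0) ->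
  u != v -> 0 < w u + w v -> (c u v <= k)%N.
Proof.
move=> wneg uv wuv; rewrite leqNgt; apply/negP => kc.
have [_ _ Edis _] := Epmd.
have notE (j : 'I_p) : (j <= k)%N -> [set u; v] \notin E j.
  move=> jk; apply: contraL (edge2 uv) => uvj.
  have jc : j != c u v by apply: contraTneq jk => ->; rewrite -ltnNge.
  by rewrite (disjointFr (Edis _ _ jc)).
have: w u + w v < 0.
  apply: wneg; rewrite /= !inE cards2 uv notE //= andbT.
  by apply/bigcupP => -[j jk]; apply/negP/notE/ltnW.
by rewrite ltNge ltW.
Qed.

(** Replacing an endpoint of [x y] by a vertex [z] of larger weight keeps the
    total weight positive. *)
Lemma heavier_vertex_cherry (w : 'I_n -> R) (x y z : 'I_n) :
  (forall u v, [set u; v] \in later_edges (c x y) -> w u + w v < 0) ->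
  uniq [:: z; x; y] -> 0 < w x + w y -> w x <= w z -> w y <= w z ->
  (c z x < c x y)%N /\ (c z y < c x y)%N.
Proof.
move=> wneg; rewrite /= !inE negb_or => /andP[/andP[zx zy]].
rewrite andbT => xy pxy xz yz.
have /(part_le_of_pos wneg zx) lzx : 0 < w z + w x by lra.
have /(part_le_of_pos wneg zy) lzy : 0 < w z + w y by lra.
rewrite leq_eqVlt val_eqE in lzx; rewrite leq_eqVlt val_eqE in lzy.
(* Equal colours are excluded because the part of [x y] is a matching. *)
split.
  case/orP: lzx => // /eqP e.
  have xz' : x != z by rewrite eq_sym.
  have ezy := part_proper xz' xy (etrans (part_sym x z) e).
  by rewrite ezy eqxx in zy.
case/orP: lzy => // /eqP e.
have yz' : y != z by rewrite eq_sym.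
have yx' : y != x by rewrite eq_sym.
have ezx := part_proper yz' yx' (etrans (part_sym y z) (etrans e (part_sym x y))).
by rewrite ezx eqxx in zx.
Qed.

(** Take for the centre an endpoint of maximal weight among the four, and join
    it to both ends of the edge that does not contain it. *)
Lemma same_part_cherry : repetition_forces_cherry c.
Proof.
move=> a b x y uq e; have [_ _ _ /(_ (c a b))[_ [w [wpos wneg]]]] := Epmd.
move: (uq); rewrite /= !inE !negb_or.
move=> /and4P[/and3P[ab ax ay] /andP[bx b_y] xy _].
have pab : 0 < w a + w b by apply: wpos; exact: edge2.
have pxy : 0 < w x + w y by apply: wpos; rewrite e; exact: edge2.
have heaviest : [\/ w x <= w a /\ w y <= w a, w x <= w b /\ w y <= w b,
    w a <= w x /\ w b <= w x | w a <= w y /\ w b <= w y].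
  case: (lerP (w b) (w a)) => ?; case: (lerP (w y) (w x)) => ?.
  - by case: (lerP (w x) (w a)) => ?; [apply: Or41|apply: Or43]; lra.
  - by case: (lerP (w y) (w a)) => ?; [apply: Or41|apply: Or44]; lra.
  - by case: (lerP (w x) (w b)) => ?; [apply: Or42|apply: Or43]; lra.
  - by case: (lerP (w y) (w b)) => ?; [apply: Or42|apply: Or44]; lra.
have wneg' u v : [set u; v] \in later_edges (c x y) -> w u + w v < 0.
  by rewrite -e; apply: wneg.
case: heaviest => -[l1 l2].
- have uz : uniq [:: a; x; y] by rewrite /= !inE negb_or ax ay xy.
  have [la lb] := heavier_vertex_cherry wneg' uz pxy l1 l2.
  exists a, x, y; rewrite e; split=> //.
  by apply/allP; rewrite /= !inE !eqxx ?orbT.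
- have uz : uniq [:: b; x; y] by rewrite /= !inE negb_or bx b_y xy.
  have [la lb] := heavier_vertex_cherry wneg' uz pxy l1 l2.
  exists b, x, y; rewrite e; split=> //.
  by apply/allP; rewrite /= !inE !eqxx ?orbT.
- have uz : uniq [:: x; a; b] by rewrite /= !inE negb_or !(eq_sym x) ax bx ab.
  have [la lb] := heavier_vertex_cherry wneg uz pab l1 l2.
  exists x, a, b; split=> //.
  by apply/allP; rewrite /= !inE !eqxx ?orbT.
- have uz : uniq [:: y; a; b] by rewrite /= !inE negb_or !(eq_sym y) ay b_y ab.
  have [la lb] := heavier_vertex_cherry wneg uz pab l1 l2.
  exists y, a, b; split=> //.
  by apply/allP; rewrite /= !inE !eqxx ?orbT.
Qed.

Lemma pmd_parts_ge : (2 <= n)%N -> (2 * n - 3 <= p)%N.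
Proof.
move=> n2; rewrite -[n in (2 * n)%N]card_ord -cardsT -[leqRHS]card_ord.
apply: leq_trans (max_card (mem (colors c [set: 'I_n]))).
by apply: card_colors_ge; [exact: part_sym|exact: part_proper|
  exact: same_part_cherry|rewrite cardsT card_ord].
Qed.

End LowerBound.

Lemma has_pmd_ge (R : realType) (n p : nat) :
  (2 <= n)%N -> has_pmd R (complete_graph n) p -> (2 * n - 3 <= p)%N.
Proof.
move=> n2 [E Epmd]; have [Ecover _ _ _] := Epmd.
have n0 : (0 < n)%N by lia.
have : exists i : 'I_p, True.
  have : [set Ordinal n0; Ordinal n2] \in edges (complete_graph n).
    by rewrite /= inE cards2.
  by rewrite -Ecover => /bigcupP[i _ _]; exists i.
case=> i0 _.
have partP e : exists i, e \in edges (complete_graph n) -> e \in E i.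
  case: (boolP (e \in edges (complete_graph n))) => [|_]; last by exists i0.
  by rewrite -Ecover => /bigcupP[i _ ei]; exists i.
have [part {}partP] := choice partP.
exact: (pmd_parts_ge Epmd partP).
Qed.

(** * The decomposition by sums of endpoints *)

Definition sum_part (n : nat) (i : 'I_(2 * n - 3)) : {set {set 'I_n}} :=
  [set e in edges (complete_graph n) | (\sum_(x in e) x == i.+1)%N].

Lemma in_sum_part (n : nat) (i : 'I_(2 * n - 3)) (u v : 'I_n) :
  ([set u; v] \in sum_part i) = (u != v) && (u + v == i.+1)%N.
Proof.
rewrite /sum_part !inE cards2; case: (altP (u =P v)) => //= uv.
by rewrite big_setU1 ?inE // big_set1.
Qed.

Lemma edge_set2 (n : nat) (e : {set 'I_n}) :
  e \in edges (complete_graph n) -> exists u v, u != v /\ e = [set u; v].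
Proof. by rewrite inE => /cards2P. Qed.

Lemma ord_neq_nat (n : nat) (u v : 'I_n) : u != v -> (u : nat) <> v.
Proof. by move=> uv /val_inj uv'; rewrite uv' eqxx in uv. Qed.

Lemma sum_part_pmd (R : realType) (n : nat) :
  (2 <= n)%N -> is_pmd R (complete_graph n) (@sum_part n).
Proof.
move=> n2; split.
- apply/setP => e; apply/bigcupP/idP => [[i _]|eG].
    by rewrite inE => /andP[].
  have [u [v [uv eE]]] := edge_set2 eG; have uv' := ord_neq_nat uv.
  have lu := ltn_ord u; have lv := ltn_ord v.
  have li : ((u + v).-1 < 2 * n - 3)%N by lia.
  exists (Ordinal li) => //; rewrite eE in_sum_part uv /=.
  by apply/eqP; lia.
- move=> i; apply/set0Pn; have li := ltn_ord i.
  (* The sum [i + 1] is attained at [0, i + 1] or, if [i + 1] is too large for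
     a vertex, at [i + 1 - (n - 1), n - 1]. *)
  have lu : (i.+1 - n.-1 < n)%N by lia.
  have lv : (minn i.+1 n.-1 < n)%N by lia.
  exists [set Ordinal lu; Ordinal lv]; rewrite in_sum_part -val_eqE /=.
  by apply/andP; split; lia.
- move=> i j ij; rewrite disjoints_subset; apply/subsetP => e.
  rewrite !inE => /andP[_ /eqP ->]; rewrite eqSS negb_and.
  by rewrite val_eqE ij orbT.
move=> i; split; first split.
- apply/subsetP => e ei; rewrite /= !inE; apply/andP; split.
    apply/bigcupP => -[j ji]; move: ei; rewrite !inE => /andP[_ /eqP ->].
    by move=> /andP[_ /eqP]; lia.
  by move: ei; rewrite !inE => /andP[].
- apply/trivIsetP => A B Ai Bi AB.
  have [a [a' [_ EA]]] : exists a a', a != a' /\ A = [set a; a'].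
    by apply: edge_set2; move: Ai; rewrite inE => /andP[].
  have [b [b' [_ EB]]] : exists b b', b != b' /\ B = [set b; b'].
    by apply: edge_set2; move: Bi; rewrite inE => /andP[].
  move: Ai Bi AB; rewrite {}EA {}EB !in_sum_part.
  move=> /andP[_ /eqP sa] /andP[_ /eqP sb] AB.
  rewrite disjoints_subset subUset !sub1set !inE.
  apply: contraNT AB; rewrite negb_and !negbK.
  rewrite -!orbA => /or4P[] /eqP e; apply/eqP.
  - by congr [set _; _] => //; apply: val_inj; move: sa sb; rewrite e /=; lia.
  - rewrite [RHS]setUC; congr [set _; _] => //.
    by apply: val_inj; move: sa sb; rewrite e /=; lia.
  - rewrite [RHS]setUC; congr [set _; _] => //.
    by apply: val_inj; move: sa sb; rewrite e /=; lia.
  - by congr [set _; _] => //; apply: val_inj; move: sa sb; rewrite e /=; lia.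
(* The total weight of [u v] is [4 (i + 1 - (u + v)) + 2], which changes sign
   between the sums [i + 1] and [i + 2]. *)
exists (fun x : 'I_n => (2 * i.+1 + 1)%N%:R - (4 * x)%N%:R); split=> u v.
  rewrite in_sum_part => /andP[_ /eqP s].
  rewrite addrACA -opprD -!natrD subr_gt0 ltr_nat; lia.
rewrite inE => /andP[]; rewrite in_sum_part => ne.
rewrite [edges _]/= inE => /andP[/bigcupP nex]; rewrite inE cards2.
case: (altP (u =P v)) ne => //= uv ne _.
rewrite addrACA -opprD -!natrD subr_lt0 ltr_nat.
suff : (i.+1 < u + v)%N by lia.
rewrite ltn_neqAle eq_sym ne leqNgt; apply/negP => lt.
have uv' := ord_neq_nat uv; have li := ltn_ord i.
have lj : ((u + v).-1 < 2 * n - 3)%N by lia.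
apply: nex; exists (Ordinal lj); first by rewrite /=; lia.
by rewrite in_sum_part uv /=; apply/eqP; lia.
Qed.

Theorem proposition3p1 (R : realType) (n : nat) (hn : (2 <= n)%N) :
  pmd R (complete_graph n) = (2 * n - 3)%N.
Proof.
rewrite /pmd; case: ex_minnP => m /asboolP hm mmin.
apply/eqP; rewrite eqn_leq (has_pmd_ge hn hm) andbT.
by apply: mmin; apply/asboolP; exists (@sum_part n); exact: sum_part_pmd.
Qed.
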